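(* Let $b,c\in\mathbb{R}$ and let $a\in\mathbb{R}$ be nonzero. Then the quadratic equation $$0=a\cdot x^2+b\cdot x+c$$ has solutions in $\mathbb{C}$ given by $$x=-\frac{b}{2a}\pm\frac{\sqrt{b^2-4\cdot a\cdot c}}{2a},$$ that is, the value of $x$ for each of the two choices of sign is a solution.
   Context: For a real number $\Delta\ge 0$, $\sqrt{\Delta}$ is the nonnegative real square root; for $\Delta<0$, $\sqrt{\Delta}$ denotes $i\sqrt{-\Delta}\in\mathbb{C}$. *)

(* Defs.v *)
From Stdlib Require Import Reals.
From Coquelicot Require Import Coquelicot.

Definition Csqrt_real (D : R) : C :=
  if Rle_dec 0 D then RtoC (sqrt D) else (Ci * RtoC (sqrt (- D)))%C.

(* Main.v *)
Require Import Defs.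
From Stdlib Require Import Reals Lra.
From Coquelicot Require Import Coquelicot.

(** Completing the square shows that at [x = - b / (2 a) + s / (2 a)] the
    polynomial [a x^2 + b x + c] takes the value
    [(s^2 - (b^2 - 4 a c)) / (4 a)], so [x] is a root as soon as [s] is any
    square root of the discriminant ([quadratic_root_of_sqrt_discr]).  The
    chosen root of a real number does square to it, also when that number is
    negative ([Csqrt_real_sqr]).  The two signs are then one case: [s] and
    [- s] have the same square. *)

Lemma Csqrt_real_sqr (D : R) : (Csqrt_real D * Csqrt_real D)%C = RtoC D.
Proof.
unfold Csqrt_real; destruct (Rle_dec 0 D) as [HD | HD].
- now rewrite <- RtoC_mult, sqrt_sqrt.
- assert (Hs : (sqrt (- D) * sqrt (- D) = - D)%R) by (apply sqrt_sqrt; lra).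
  apply injective_projections; simpl; lra.
Qed.

(** The square root [s] is arbitrary rather than a chosen one, so that both
    signs of the quadratic formula are instances. *)
Lemma quadratic_root_of_sqrt_discr (a b c s : C) :
  a <> 0%C -> (s * s = b * b - 4 * a * c)%C ->
  let x := (- (b / (2 * a)) + s / (2 * a))%C in
  (a * (x * x) + b * x + c = 0)%C.
Proof.
intros Ha Hs x.
assert (H2 : RtoC 2 <> RtoC 0) by (intros E; apply RtoC_inj in E; lra).
(* [field] treats numerals embedded in [C] as atoms, so [4] has to be
   expressed through [2]. *)
assert (H4 : RtoC 4 = (2 * 2)%C) by (rewrite <- RtoC_mult; f_equal; lra).
assert (Hx : (a * (x * x) + b * x + c
              = (s * s - (b * b - 4 * a * c)) / (4 * a))%C).
{ unfold x; rewrite H4; field; auto. }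
rewrite Hx, Hs; rewrite H4; field; auto.
Qed.

Theorem corollary2p1 :
  forall (a b c : R), a <> 0%R ->
  forall x : C,
    (x = - (RtoC b / (2 * RtoC a))
         + Csqrt_real (b ^ 2 - 4 * a * c)%R / (2 * RtoC a)
     \/
     x = - (RtoC b / (2 * RtoC a))
         - Csqrt_real (b ^ 2 - 4 * a * c)%R / (2 * RtoC a))%C ->
    (RtoC 0 = RtoC a * x ^ 2 + RtoC b * x + RtoC c)%C.
Proof.
intros a b c Ha x Hx.
assert (HaC : RtoC a <> RtoC 0) by (intros E; now apply Ha, RtoC_inj).
assert (H2 : RtoC 2 <> RtoC 0) by (intros E; apply RtoC_inj in E; lra).
pose proof (Csqrt_real_sqr (b ^ 2 - 4 * a * c)) as Hs.
set (s := Csqrt_real (b ^ 2 - 4 * a * c)) in *.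
assert (HD : RtoC (b ^ 2 - 4 * a * c) = (b * b - 4 * a * c)%C).
{ rewrite RtoC_minus, !RtoC_mult; simpl; now rewrite Rmult_1_r, RtoC_mult. }
rewrite HD in Hs.
replace (x ^ 2)%C with (x * x)%C by (simpl; ring).
symmetry; destruct Hx as [-> | ->].
- now apply quadratic_root_of_sqrt_discr.
- replace (- (RtoC b / (2 * RtoC a)) - s / (2 * RtoC a))%C
    with (- (RtoC b / (2 * RtoC a)) + (- s) / (2 * RtoC a))%C by (field; auto).
  apply quadratic_root_of_sqrt_discr; [exact HaC |].
  rewrite <- Hs; ring.
Qed.
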